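(* Let $K$ be a compact connected semisimple Lie group and let $\mathcal{O}\subset\mathfrak{k}$ be a coadjoint orbit with convex hull $\widehat{\mathcal{O}}$. If $F\subset\widehat{\mathcal{O}}$ is a face, there is a maximal torus $T\subset K$ that preserves $F$, i.e. $\mathrm{Ad}(t)F=F$ for all $t\in T$.
   Context: $\mathfrak{k}$ is the Lie algebra of $K$, identified with $\mathfrak{k}^*$ by minus the Killing form, so that a coadjoint orbit is an adjoint orbit in $\mathfrak{k}$. A face of a convex set $E$ is a convex subset $F\subset E$ such that if $x,y\in E$ and the relative interior of $[x,y]$ meets $F$, then $[x,y]\subset F$. *)

(* Defs.v *)
(* MathComp + MathComp-Analysis *)
From HB Require Import structures.
From mathcomp Require Import all_boot all_order all_algebra.
From mathcomp Require Import all_classical all_reals all_analysis.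

Set Implicit Arguments.
Unset Strict Implicit.
Unset Printing Implicit Defensive.

Import Order.TTheory GRing.Theory Num.Theory.
Import numFieldNormedType.Exports.

Local Open Scope classical_set_scope.
Local Open Scope ring_scope.

(* The algebra and the topology are only joined here; their compatibility is
   part of [is_lie_group]. *)
#[short(type="groupTopType")]
HB.structure Definition GroupTop := {K of Topological K & Group K}.

(* [class_C k U f]: f is of class C^k on U, where U is meant to be an open subset
   of a finite-dimensional V. *)
Fixpoint class_C (R : realType) (V W : normedModType R) (k : nat) (U : set V)
    (f : V -> W) {struct k} : Prop :=
  match k with
  | 0 => forall x, U x -> {for x, continuous f}
  | k'.+1 => (forall x, U x -> differentiable f x) /\
             (forall v : V, class_C k' U (fun x => 'D_v f x))
  end.

Definition smooth_on (R : realType) (V W : normedModType R) (U : set V)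
    (f : V -> W) : Prop := forall k, class_C k U f.

(* [coord] and [param] are total functions; only their restrictions to [dom]
   and to [coord @` dom] are meaningful. *)
Record chart (R : realType) (m : nat) (K : groupTopType) := Chart {
  dom : set K;
  coord : K -> 'rV[R]_m;
  param : 'rV[R]_m -> K
}.

Section LieGroup.
Context (R : realType) (m : nat) (K : groupTopType).
Implicit Types (a b c : chart R m K) (A : set (chart R m K)).

Definition codom c : set 'rV[R]_m := coord c @` dom c.

Record is_chart c : Prop := {
  chart_open : open (dom c);
  chart_codom_open : open (codom c);
  chart_coordK : forall g, dom c g -> param c (coord c g) = g;
  chart_coord_cont : forall g, dom c g -> {for g, continuous (coord c)};
  chart_param_cont : forall x, codom c x -> {for x, continuous (param c)}
}.

(* K, with the smooth structure generated by the atlas A, is a real Lie group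
   of dimension m. *)
Record is_lie_group A : Prop := {
  lie_hausdorff : hausdorff_space K;
  lie_second_countable : @second_countable K;
  lie_chart : forall c, A c -> is_chart c;
  lie_cover : forall g : K, exists2 c, A c & dom c g;
  lie_transition : forall a b, A a -> A b ->
    smooth_on [set x | codom a x /\ dom b (param a x)]
              (fun x => coord b (param a x));
  lie_mul_cont : continuous (fun p : K * K => (p.1 * p.2)%g);
  lie_inv_cont : continuous (fun g : K => (g^-1)%g);
  lie_mul_smooth : forall a b c, A a -> A b -> A c ->
    smooth_on [set p : 'rV[R]_m * 'rV[R]_m |
                 [/\ codom a p.1, codom b p.2
                   & dom c (param a p.1 * param b p.2)%g]]
              (fun p => coord c (param a p.1 * param b p.2)%g);
  lie_inv_smooth : forall a b, A a -> A b ->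
    smooth_on [set x | codom a x /\ dom b (param a x)^-1%g]
              (fun x => coord b (param a x)^-1%g)
}.

(* The Lie algebra, i.e. the tangent space of K at 1, is read as 'rV[R]_m
   through the differential at 1 of a chart c around 1. *)

(* Ad g is the differential at 1 of h |-> g h g^-1. *)
Definition Ad c (g : K) : 'rV[R]_m -> 'rV[R]_m :=
  'd (fun x => coord c (g * param c x * g^-1)%g) (coord c 1%g).

(* [X, Y] = ad X Y, where ad is the differential at 1 of g |-> Ad g. *)
Definition lie_bracket c (X Y : 'rV[R]_m) : 'rV[R]_m :=
  'd (fun x => Ad c (param c x) Y) (coord c 1%g) X.

Definition killing c (X Y : 'rV[R]_m) : R :=
  \tr (lin1_mx (fun Z => lie_bracket c X (lie_bracket c Y Z))).

Definition lie_ideal c (V : {vspace 'rV[R]_m}) : Prop :=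
  forall X Y, Y \in V -> lie_bracket c X Y \in V.

Definition derived c (V : {vspace 'rV[R]_m}) : {vspace 'rV[R]_m} :=
  (<<[seq lie_bracket c X Y | X <- vbasis V, Y <- vbasis V]>>)%VS.

Definition lie_solvable c (V : {vspace 'rV[R]_m}) : Prop :=
  exists k, iter k (derived c) V = 0%VS.

Definition semisimple c : Prop :=
  forall V, lie_ideal c V -> lie_solvable c V -> V = 0%VS.

Definition minus_killing c (X : 'rV[R]_m) : 'rV[R]_m -> R :=
  fun Y => - killing c X Y.

Definition coadjoint_orbit c (l : {scalar 'rV[R]_m}) : set ('rV[R]_m -> R) :=
  [set (fun Y => l (Ad c (g^-1)%g Y)) | g in [set: K]].

(* Coadjoint orbits, transported from the dual to the Lie algebra itself by
   X |-> - killing X. *)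
Definition is_coadjoint_orbit c (O : set 'rV[R]_m) : Prop :=
  exists l : {scalar 'rV[R]_m}, O = minus_killing c @^-1` coadjoint_orbit c l.

End LieGroup.

Section Torus.
Context (K : groupTopType).
Implicit Types S T : set K.

Record is_subgroup T : Prop := {
  subgroup1 : T 1%g;
  subgroupM : forall g h, T g -> T h -> T (g * h)%g;
  subgroupV : forall g, T g -> T g^-1%g
}.

(* In a Lie group a compact subgroup is closed, hence a Lie subgroup. *)
Record is_torus T : Prop := {
  torus_subgroup : is_subgroup T;
  torus_compact : compact T;
  torus_connected : connected T;
  torus_abelian : forall g h, T g -> T h -> (g * h = h * g)%g
}.

Definition is_maximal_torus T : Prop :=
  is_torus T /\ forall S, is_torus S -> T `<=` S -> S = T.

End Torus.

Section Convex.
Context (R : realType) (M : lmodType R).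
Implicit Types E F : set M.

Definition convex_hull E : set M := smallest (@convex_set R M) E.

Definition segment (x y : M) : set M :=
  [set (1 - t) *: x + t *: y | t in `[0, 1]%classic].

(* The relative interior of [segment x y]; this is [set x] when x = y. *)
Definition open_segment (x y : M) : set M :=
  [set (1 - t) *: x + t *: y | t in `]0, 1[%classic].

Definition is_face E F : Prop :=
  [/\ @convex_set R M F, F `<=` E
    & forall x y, E x -> E y ->
        open_segment x y `&` F !=set0 -> segment x y `<=` F].

End Convex.

(* Main.v *)
From HB Require Import structures.
From mathcomp Require Import all_boot all_order all_algebra.
From mathcomp Require Import all_classical all_reals all_analysis.
From mathcomp Require Import ring lra.
Require Import Defs.

(* Let X be a point in the relative interior of F. A linear automorphism of the
   orbitope that fixes X maps F to a face containing X, hence preserves F; so it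
   suffices to find a maximal torus fixing X. The closure of the one-parameter
   subgroup generated by X is a torus; a maximal torus containing it commutes
   with this subgroup and therefore fixes its velocity X. *)

Set Implicit Arguments.
Unset Strict Implicit.
Unset Printing Implicit Defensive.

Import Order.TTheory GRing.Theory Num.Theory.
Import numFieldNormedType.Exports.

Local Open Scope classical_set_scope.
Local Open Scope ring_scope.

(** Two points carry the weight. The velocity argument needs a curve in the torus that is tangent to
    [X] at 1. No differential equation is solved: the curve is a limit of powers, available because
    K is compact, and only two facts about it are kept, multiplicativity at nonnegative times and a
    first-order expansion at 0. They suffice: if [g] commutes with the curve, conjugation by [g]
    fixes points that approach 1 along [X], so its differential fixes [X]. That Ad preserves the
    orbitope is not immediate either, since the orbit is pulled back from the dual through the
    Killing form. This form must be shown Ad-invariant, hence the bracket Ad-equivariant. As the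
    bracket is itself a differential of Ad, this rests on the differentiability of Ad in the group
    variable, where second derivatives of the multiplication enter. *)

Section RelativeInterior.
Context (R : realType) (m : nat).
Implicit Types (F : set 'rV[R]_m) (X v w y z : 'rV[R]_m).

(** * Relative interior points of convex sets *)

Lemma convex_setP F : @convex_set R 'rV[R]_m F -> forall x y (t : R),
  F x -> F y -> 0 <= t <= 1 -> F (t *: x + (1 - t) *: y).
Proof.
move=> cF x y t Fx Fy t01.
have := cF x y (Itv01 (andP t01).1 (andP t01).2).
by rewrite !inE; apply.
Qed.

Let cvx F := @convex_set R 'rV[R]_m F.

Let dir F X v := exists2 e : R, 0 < e & forall t, `|t| <= e -> F (X + t *: v).

Let dirZ F X v (a : R) : dir F X v -> dir F X (a *: v).
Proof.
move=> [e e0 Fe]; have a1 : 0 < `|a| + 1 by rewrite ltr_wpDl.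
exists (e / (`|a| + 1)); first exact: divr_gt0.
move=> t te; rewrite scalerA; apply: Fe; rewrite normrM.
rewrite ler_pdivlMr // in te; apply: le_trans te.
by rewrite ler_wpM2l // lerDl.
Qed.

Let dirD F X v w : cvx F -> dir F X v -> dir F X w -> dir F X (v + w).
Proof.
move=> cF [e e0 Fe] [d d0 Fd].
(* The move by [t] along [v + w] is the midpoint of moves by [t * 2] along [v] and along [w], hence
   the halved radius. *)
exists (Num.min e d / 2); first by rewrite divr_gt0 // lt_min e0.
move=> t; rewrite ler_pdivlMr // le_min => /andP[te td].
have -> : X + t *: (v + w) =
    2^-1 *: (X + (t * 2) *: v) + (1 - 2^-1) *: (X + (t * 2) *: w).
  by apply/rowP => i; rewrite !mxE; field.
apply: convex_setP => //; last lra.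
- by apply: Fe; rewrite normrM [`|2|]ger0_norm.
- by apply: Fd; rewrite normrM [`|2|]ger0_norm.
Qed.

Let dir_sum F X I (r : seq I) (u : I -> 'rV[R]_m) : cvx F -> F X ->
  (forall i, dir F X (u i)) -> dir F X (\sum_(i <- r) u i).
Proof.
move=> cF FX du; elim/big_ind: _ => //.
- by exists 1 => // t _; rewrite scaler0 addr0.
- by move=> *; exact: dirD.
Qed.

Let mid X y := 2^-1 *: X + (1 - 2^-1) *: y.

Let dir_mid F X v y : cvx F -> F y -> dir F X v -> dir F (mid X y) v.
Proof.
move=> cF Fy [e e0 Fe]; exists (e / 2); first exact: divr_gt0.
move=> t; rewrite ler_pdivlMr // => te.
have -> : mid X y + t *: v = 2^-1 *: (X + (t * 2) *: v) + (1 - 2^-1) *: y.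
  by apply/rowP => i; rewrite !mxE; field.
apply: convex_setP => //; last lra.
by apply: Fe; rewrite normrM [`|2|]ger0_norm.
Qed.

Let dir_mid_sub F X y : cvx F -> F X -> F y -> dir F (mid X y) (y - X).
Proof.
move=> cF FX Fy; exists 2^-1; first by rewrite invr_gt0.
move=> t /ler_normlP[t1 t2].
have -> : mid X y + t *: (y - X) = (2^-1 - t) *: X + (1 - (2^-1 - t)) *: y.
  by apply/rowP => i; rewrite !mxE; field.
by apply: convex_setP => //; lra.
Qed.

(* The v with X +- e v in F for some e > 0 form a subspace dir F X, and
   passing from X to the midpoint of X and y adds the direction y - X to it. So
   at an X where its dimension is maximal it contains all the y - X. *)
Lemma convex_relative_interior F : @convex_set R 'rV[R]_m F -> F !=set0 ->
  exists2 X, F X & forall y, F y -> exists2 z, F z & open_segment y z X.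
Proof.
move=> cF [X0 FX0].
pose P n := `[< exists X (s : seq 'rV[R]_m), [/\ F X, free s, size s = n &
                             forall v, v \in s -> dir F X v] >].
have P0 : exists n, P n.
  exists 0; apply/asboolP; exists X0, [::]; split => //.
  by rewrite /free span_nil dimv0.
have Pb n : P n -> (n <= \dim {:'rV[R]_m})%N.
  move=> /asboolP[X [s [_ fs <- _]]].
  by rewrite -(eqP fs) dimvS // subvf.
case: (ex_maxnP P0 Pb) => n /asboolP[X [s [FX fs sn ds]]] nmax.
exists X => // y Fy.
have ys : y - X \in span s.
  apply: contrapT => /negP yns.
  suff /nmax : P n.+1 by rewrite ltnn.
  apply/asboolP; exists (mid X y), (y - X :: s); split.
  - by apply: convex_setP => //; lra.
  - by rewrite free_cons yns.
  - by rewrite /= sn.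
  - move=> v; rewrite inE => /orP[/eqP ->|vs]; first exact: dir_mid_sub.
    by apply: dir_mid => //; exact: ds.
have [e e0 Fe] : dir F X (y - X).
  rewrite (coord_span (X := in_tuple s) ys); apply: dir_sum => // i.
  apply: dirZ; apply: ds; exact: mem_nth.
(* Prolong the segment from [y] beyond [X] by the ratio [e]; then [X] sits at parameter 1 / (1 + e)
   between [y] and the new end point. *)
exists (X + (- e) *: (y - X)); first by apply: Fe; rewrite normrN gtr0_norm.
exists (1 + e)^-1.
  rewrite /= in_itv /= invr_gt0 invf_lt1 ?ltrDl ?e0 ?andbT; last by lra.
  by lra.
have e1 : 1 + e != 0 by rewrite gt_eqF //; lra.
by apply/rowP => i; rewrite !mxE; field.
Qed.

End RelativeInterior.

(** * Closures of abelian subgroups and existence of maximal tori *)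

Section MaximalTorus.
Context (K : groupTopType) (hausK : hausdorff_space K).
Hypothesis Kcompact : compact [set: K].
Hypothesis mul_cont : continuous (fun p : K * K => (p.1 * p.2)%g).
Hypothesis inv_cont : continuous (fun g : K => (g^-1)%g).

(** The group laws pass to the closure by continuity, and commutativity because the neighbourhoods
    of [g * h] and [h * g] cannot be separated. *)
Lemma closure_torus (H : set K) : is_subgroup H -> connected H ->
  (forall g h, H g -> H h -> (g * h = h * g)%g) -> is_torus (closure H).
Proof.
move=> [H1 HM HV] Hconn Hab; split.
- split; first exact: subset_closure.
  + move=> g h Hg Hh B /(@mul_cont (g, h))[[U V] /= [gU hV] UV].
    have [g' [Hg' Ug']] := Hg _ gU; have [h' [Hh' Vh']] := Hh _ hV.
    by exists (g' * h')%g; split; [exact: HM|exact: (UV (g', h'))].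
  + move=> g Hg B /(@inv_cont g) /Hg [h [Hh Bh]].
    by exists (h^-1)%g; split => //; exact: HV.
- by apply: subclosed_compact Kcompact _ => //; exact: closed_closure.
- exact: connected_closure.
- move=> g h Hg Hh; apply: hausK => A B.
  move=> /(@mul_cont (g, h))[[U V] /= [gU hV] UV].
  move=> /(@mul_cont (h, g))[[V' U'] /= [hV' gU'] UV'].
  have [g' [Hg' [Ug' Ug'']]] := Hg _ (filterI gU gU').
  have [h' [Hh' [Vh' Vh'']]] := Hh _ (filterI hV hV').
  exists (g' * h')%g; split; first exact: (UV (g', h')).
  by rewrite Hab //; exact: (UV' (h', g')).
Qed.

(** Zorn's lemma on the tori containing [S]. The union of a chain may fail to be compact, so its
    closure serves as the upper bound. *)
Lemma sub_maximal_torus (S : set K) : is_torus S ->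
  exists2 T, is_maximal_torus T & S `<=` T.
Proof.
move=> torS.
pose Q := {T : set K | is_torus T /\ S `<=` T}.
pose le (T1 T2 : Q) := `[< sval T1 `<=` sval T2 >].
have [T|T1 T2 T3 /asboolP T12 /asboolP T23|T1 T2 /asboolP T12 /asboolP T21|C Ctot|T Tmax]
    := @Zorn Q le.
- by apply/asboolP.
- by apply/asboolP; exact: subset_trans T23.
- case: T1 T2 T12 T21 => [T1 p1] [T2 p2] /= T12 T21.
  by apply: eq_exist; rewrite eqEsubset; split.
- have [[T0 CT0]|C0] := pselect (C !=set0); last first.
    by exists (exist _ S (conj torS (@subset_refl _ S))) => T CT; case: C0; exists T.
  pose H := \bigcup_(T in C) sval T.
  have two g h : H g -> H h -> exists2 T, C T & sval T g /\ sval T h.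
    move=> [T1 C1 Tg] [T2 C2 Th].
    by have [/asboolP l|/asboolP l] := Ctot _ _ C1 C2;
      [exists T2 => //; split=> //; exact: l|exists T1 => //; split=> //; exact: l].
  have tor (T : Q) : is_torus (sval T) by have [] := svalP T.
  have torH : is_torus (closure H).
    apply: closure_torus; first split.
    + by exists T0 => //; case: (tor T0) => -[].
    + move=> g h Hg Hh; have [T CT [Tg Th]] := two _ _ Hg Hh.
      by exists T => //; case: (tor T) => -[_ TM _] _ _ _; exact: TM.
    + move=> g [T CT Tg]; exists T => //.
      by case: (tor T) => -[_ _ TV] _ _ _; exact: TV.
    + apply: bigcup_connected; last by move=> T _; case: (tor T).
      by exists 1%g => T _; case: (tor T) => -[].
    + move=> g h Hg Hh; have [T CT [Tg Th]] := two _ _ Hg Hh.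
      by case: (tor T) => _ _ _; apply.
  have SH : S `<=` closure H.
    move=> g Sg; apply: subset_closure; exists T0 => //.
    by have [_] := svalP T0; apply.
  exists (exist _ (closure H) (conj torH SH)) => T CT; apply/asboolP => /= g Tg.
  by apply: subset_closure; exists T.
- exists (sval T); last by have [] := svalP T.
  have [torT ST] := svalP T; split => // T' torT' TT'.
  have := Tmax (exist _ T' (conj torT' (subset_trans ST TT'))).
  by move=> <- //; apply/asboolP.
Qed.

End MaximalTorus.

(** * First-order calculus in normed spaces *)

Section Calculus.
Context (R : realType).

(** Identities between maps read in charts hold only near the base point, where the chart domains
    match; differentials must therefore be compared on germs. *)
Lemma near_eq_diff (V W : normedModType R) (f g : V -> W) (x : V) :
  {near x, f =1 g} -> differentiable f x ->
  differentiable g x /\ 'd g x = 'd f x :> (V -> W).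
Proof.
move=> fg df.
have gE : g \o shift x = cst (g x) + 'd f x +o_ 0 id.
  rewrite -(nbhs_singleton fg).
  apply/eqaddoP => e e0.
  have /eqaddoP/(_ e e0) fE := diff_locally df.
  have fg0 : \forall y \near 0, f (y + x) = g (y + x).
    by move: fg; rewrite (near_shift 0); apply: filterS => y; rewrite /= subr0.
  apply: filterS2 fg0 fE => y.
  by rewrite -![(_ - _) y]/(_ y - _ y) /= => <-.
have dE := diff_unique (diff_continuous df) gE.
by split=> //; apply/diff_locallyP; rewrite dE; split=> //; exact: diff_continuous.
Qed.

Lemma rV_norm_le (m : nat) (v : 'rV[R]_m) (a : R) :
  0 <= a -> (forall j, `|v 0 j| <= a) -> `|v| <= a.
Proof.
move=> a0 va; rewrite [leLHS]/Num.Def.normr/= mx_normrE.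
by apply: bigmax_le => // -[i j] _; rewrite /= (ord1 i).
Qed.

Lemma rV_coord_le (m : nat) (v : 'rV[R]_m) (j : 'I_m) : `|v 0 j| <= `|v|.
Proof.
rewrite [leRHS]/Num.Def.normr/= mx_normrE.
by apply: le_trans; last exact: (le_bigmax _ _ (0, j)).
Qed.

(** The norm is the maximum of the coordinates, so the scalar mean value theorem applies to each
    coordinate, with its own intermediate point. *)
Lemma mean_value_rV (m : nat) (h : R -> 'rV[R]_m) (a : R) :
  (forall t : R, 0 <= t <= 1 -> differentiable h t) ->
  (forall t : R, 0 <= t <= 1 -> `|'d h t 1| <= a) -> `|h 1 - h 0| <= a.
Proof.
move=> dh ha.
have a0 : 0 <= a by apply: le_trans (ha 0 _); rewrite ?lexx ?ler01.
apply: rV_norm_le => // j; rewrite !mxE.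
have hj (t : R) : 0 <= t <= 1 -> is_derive t 1 (fun t => h t 0 j) ('d h t 1 0 j).
  move=> t01; have dht : derivable h t 1 by apply/diff_derivable/dh.
  split; first by have /derivable_mxP := dht; apply.
  by rewrite -deriveE; [rewrite derive_mx // mxE|exact: dh].
have [t] : exists2 t : R, t \in `[0, 1]%R &
    h 1 0 j - h 0 0 j = ('d h t 1 0 j) * (1 - 0).
  apply: (@MVT_segment R (fun t => h t 0 j) (fun t => 'd h t 1 0 j) 0 1) => //.
  - by move=> t; rewrite in_itv /= => /andP[? ?]; apply: hj; rewrite !ltW.
  - apply: derivable_within_continuous => t; rewrite in_itv /= => t01.
    by case: (hj t t01).
rewrite in_itv /= subr0 mulr1 => t01 ->.
exact: le_trans (rV_coord_le _ _) (ha t t01).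
Qed.

Lemma linear_near_id (m : nat) (L : {linear 'rV[R]_m -> 'rV[R]_m}) (a : R) :
  (forall i, `|L (delta_mx 0 i) - delta_mx 0 i| <= a) ->
  forall v, `|L v - v| <= (m%:R * a) * `|v|.
Proof.
move=> La v; rewrite [in L v](row_sum_delta v) {2}(row_sum_delta v).
rewrite linear_sum -sumrB /=.
apply: le_trans (ler_norm_sum _ _ _) _.
have -> : m%:R * a * `|v| = \sum_(i < m) (`|v| * a).
  by rewrite sumr_const card_ord -mulr_natl; ring.
apply: ler_sum => i _; rewrite linearZ /= -scalerBr normrZ.
by apply: ler_pM => //; exact: rV_coord_le.
Qed.

Lemma is_diff_line (V W : normedModType R) (f : V -> W) (p v : V) (t : R) :
  differentiable f (p + t *: v) ->
  is_diff t (fun t : R => f (p + t *: v)) (fun s => 'd f (p + t *: v) (s *: v)).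
Proof.
move=> df.
have dl : is_diff t (fun t : R => p + t *: v) (fun s => s *: v).
  have -> : (fun t : R => p + t *: v) = cst p + *:%R ^~ v by [].
  have := is_diffD (is_diff_cst p t) (is_diff_scalel t v).
  by move=> /is_diff_eq; apply; rewrite add0r.
have := @is_diff_comp _ _ _ _ _ _ f ('d f (p + t *: v)) _ dl (differentiableP df).
exact.
Qed.

(* The partial differential of mu in its second argument is the identity at
   (e, e), hence close to it nearby: apply the mean value inequality on the
   segment from (x, e) to (x, y). *)
Lemma unital_first_order (m : nat) (mu : 'rV[R]_m * 'rV[R]_m -> 'rV[R]_m)
    (e : 'rV[R]_m) :
  (\forall p \near (e, e), differentiable mu p) ->
  (forall v, {for (e, e), continuous (fun p => 'D_v mu p)}) ->
  (\forall x \near e, mu (x, e) = x) -> (\forall y \near e, mu (e, y) = y) ->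
  forall eps, 0 < eps -> exists2 d, 0 < d & forall x y,
    `|x - e| < d -> `|y - e| < d -> `|mu (x, y) - x - (y - e)| <= eps * `|y - e|.
Proof.
move=> dmu cmu mu1 mu2 eps eps0.
(* Expansion in the standard basis will cost a factor [m]; dividing by [m.+1] absorbs it and is safe
   for [m = 0]. *)
pose eps' := eps / m.+1%:R; have eps'0 : 0 < eps' by rewrite divr_gt0.
have D2 v : 'D_(0, v) mu (e, e) = v.
  rewrite deriveE; last exact: nbhs_singleton dmu.
  have inj : is_diff e (fun y : 'rV[R]_m => (e, y)) (fun v => (0, v)).
    exact: is_diff_pair.
  have dc := @is_diff_comp _ _ _ _ _ _ mu _ e inj
               (differentiableP (nbhs_singleton dmu)).
  have [] := near_eq_diff (f := id) (g := mu \o (fun y => (e, y))) (x := e) _ _.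
  - by near=> y; rewrite /= (near mu2 y).
  - by case: (is_diff_id e).
  - move=> _ dE; have [_ dcE] := dc; have [_ idE] := is_diff_id e.
    exact: (congr1 (@^~ v) (etrans (esym dcE) (etrans dE idE))).
have cl : \forall p \near (e, e), forall i : 'I_m,
    `|'D_(0, delta_mx 0 i) mu p - delta_mx 0 i| <= eps'.
  apply: (@filter_forall _ _ _ (nbhs (e, e)) _) => i; have := cmu (0, delta_mx 0 i).
  move=> /cvgrPdist_le/(_ _ eps'0). apply: filterS => p /=.
  by rewrite D2 distrC.
have [d /= d0 Hd] : nbhs_ball (e, e) [set p | differentiable mu p /\
    (forall i : 'I_m, `|'D_(0, delta_mx 0 i) mu p - delta_mx 0 i| <= eps')].
  by apply/nbhs_ballP; exact: filterI.
have [d' /= d'0 Hd'] : nbhs_ball e [set x | mu (x, e) = x] by exact/nbhs_ballP.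
exists (Num.min d d'); first by rewrite lt_min d0.
move=> x y; rewrite !lt_min => /andP[xd xd'] /andP[yd _].
set w := y - e.
(* Subtracting [t *: w] makes the derivative of [h] the deviation of the partial differential from
   the identity. *)
pose h (t : R) := mu ((x, e) + t *: (0, w)) - t *: w.
have line (t : R) : 0 <= t <= 1 -> ball (e, e) d ((x, e) + t *: (0, w)).
  move=> /andP[t0 t1]; split; rewrite -ball_normE /= distrC.
    by rewrite scaler0 addr0.
  rewrite [e + _ - e]addrC addKr normrZ ger0_norm //.
  by apply: le_lt_trans yd; rewrite ler_piMl.
have dht (t : R) : 0 <= t <= 1 ->
    is_diff t h (fun s => 'd mu ((x, e) + t *: (0, w)) (s *: (0, w)) - s *: w).
  move=> /line /Hd [dm _]; have dl := is_diff_line dm.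
  have -> : h = (fun t => mu ((x, e) + t *: (0, w))) - *:%R ^~ w by [].
  exact: is_diffB.
have -> : mu (x, y) - x - w = h 1 - h 0.
  rewrite /h !scale1r !scale0r subr0 addr0 Hd'; last by rewrite -ball_normE /= distrC.
  by rewrite -[(x, e) + _]/(x + 0, e + w) addr0 /w subrKC addrAC.
apply: mean_value_rV => t t01; have dh := dht t t01; first by case: dh.
rewrite (_ : 'd h t 1 = 'd mu ((x, e) + t *: (0, w)) (0, w) - w); last first.
  by case: dh => _ ->; rewrite !scale1r.
have [dm Di] := Hd _ (line _ t01).
pose L v := 'd mu ((x, e) + t *: (0, w)) (0, v).
have Llin : linear L.
  move=> a u v; rewrite /L -linearP; congr ('d _ _ _).
  by rewrite -[RHS]/(a *: 0 + 0, a *: u + v) scaler0 addr0.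
pose LM := GRing.isLinear.Build _ _ _ _ _ Llin.
pose LL : {linear _ -> _} := HB.pack L LM.
apply: le_trans (@linear_near_id m LL eps' _ w) _.
  by move=> i; have := Di i; rewrite deriveE.
rewrite ler_wpM2r // /eps' mulrCA ger_pMr // ler_pdivrMr // mul1r ler_nat.
exact: leqnSn.
Unshelve. all: by end_near. Qed.

(** Expanding [phi (y s) = y s] to first order gives s dphi(X) = s X + o(s); divide by [s]. *)
Lemma diff_fixed_velocity (V : normedModType R) (phi : V -> V) (e X : V)
    (y : R -> V) :
  differentiable phi e -> phi e = e ->
  (forall eps, 0 < eps -> exists2 d, 0 < d & forall s, 0 < s <= d ->
     phi (y s) = y s /\ `|y s - e - s *: X| <= eps * s) ->
  'd phi e X = X.
Proof.
move=> dphi phie Hy.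
have [L L0 HL] := linear_lipschitz (diff_continuous dphi).
apply/eqP; rewrite eq_sym -subr_eq0 -normr_le0; apply/ler_addgt0Pr => r r0.
rewrite add0r; pose C := `|X| + 2 + L.
have C0 : 0 < C by rewrite /C; have := normr_ge0 X; lra.
(* [D] adds up three errors, in units of [eps * s]: the remainder of [phi] at a displacement of norm
   at most [s * C], the velocity error, and its image under the differential, which has Lipschitz
   constant [L]. *)
pose D := C + 1 + L; have D0 : 0 < D by rewrite /D; lra.
pose eps := Num.min 1 (r / D).
have eps0 : 0 < eps by rewrite lt_min ltr01 divr_gt0.
have [d d0 Hd] := Hy _ eps0.
have /eqaddoP/(_ _ eps0) := diff_locally dphi.
move=> /nbhs_ballP[d' /= d'0 Hd'].
pose s := Num.min d (d' / (C * 2)).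
have s0 : 0 < s by rewrite lt_min d0 divr_gt0 // mulr_gt0.
have [|ys sX] := Hd s; first by rewrite s0 ge_min lexx.
set h := y s - e in sX.
have hs : `|h| <= s * C.
  rewrite -(subrK (s *: X) h); apply: le_trans (ler_normD _ _) _.
  rewrite normrZ gtr0_norm //.
  have : eps * s <= s by rewrite ger_pMl // ge_min lexx.
  rewrite /C; nra.
have hd : ball 0 d' h.
  rewrite -ball_normE /= sub0r normrN; apply: le_lt_trans hs _.
  have : s <= d' / (C * 2) by rewrite ge_min lexx orbT.
  by rewrite ler_pdivlMr ?mulr_gt0 // => ?; nra.
have := Hd' _ hd.
rewrite -![(_ - _) _]/(_ h - _ h) /= -[(_ + _) _]/(phi e + 'd phi e h).
rewrite {1}/h subrK ys phie opprD addrA -/h => hphi.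
(* At [v = h] the first difference is the remainder of [phi], because [y s] and [e] are fixed
   points; the second sees only the velocity error. *)
have E v : s *: (X - 'd phi e X) =
    (v - 'd phi e v) - ((v - s *: X) - 'd phi e (v - s *: X)).
  have -> : 'd phi e (v - s *: X) = 'd phi e v - s *: 'd phi e X.
    by rewrite linearB linearZ.
  by rewrite scalerBr opprB addrA subrKA opprB [RHS]addrC subrKA.
have : s * `|X - 'd phi e X| <= eps * (s * C) + (eps * s + L * (eps * s)).
  rewrite -{1}(gtr0_norm s0) -normrZ (E h); apply: le_trans (ler_normB _ _) _.
  apply: lerD; first by apply: le_trans hphi _; rewrite ler_pM2l.
  apply: le_trans (ler_normB _ _) _; apply: lerD => //.
  by apply: le_trans (HL _) _; rewrite ler_pM2l.
move=> bound; have epsD : eps * D <= r by rewrite -ler_pdivlMr // ge_min lexx orbT.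
rewrite -(ler_pM2l s0); apply: le_trans bound _.
have -> : eps * (s * C) + (eps * s + L * (eps * s)) = s * (eps * D).
  by rewrite /D; ring.
by rewrite ler_pM2l.
Qed.

End Calculus.

(** * The adjoint representation, the Killing form and the orbitope *)

Section LieGroupCalculus.
Context (R : realType) (m : nat) (K : groupTopType).
Context (A : set (chart R m K)) (hK : is_lie_group A).
Implicit Types (a b c d : chart R m K) (g h : K).

Lemma chart_nbhs a g : A a -> dom a g -> nbhs g (dom a).
Proof.
by move=> Aa ag; apply: open_nbhs_nbhs; split => //; exact: chart_open (lie_chart hK Aa).
Qed.

Lemma codom_nbhs a x : A a -> codom a x -> nbhs x (codom a).
Proof.
move=> Aa ax; apply: open_nbhs_nbhs; split => //.
exact: chart_codom_open (lie_chart hK Aa).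
Qed.

Lemma coord_codom a g : dom a g -> codom a (coord a g).
Proof. by move=> ag; exists g. Qed.

Lemma paramK a x : A a -> codom a x ->
  dom a (param a x) /\ coord a (param a x) = x.
Proof. by move=> Aa [g ag <-]; rewrite (chart_coordK (lie_chart hK Aa) ag). Qed.

Lemma coordK a g : A a -> dom a g -> param a (coord a g) = g.
Proof. by move=> Aa; exact: chart_coordK (lie_chart hK Aa) g. Qed.

Lemma near_param a g (P : set K) : A a -> dom a g -> nbhs g P ->
  \forall x \near coord a g, P (param a x).
Proof.
move=> Aa ag gP; apply: (chart_param_cont (lie_chart hK Aa) (coord_codom ag)).
by rewrite coordK.
Qed.

(** [Ad c g] unfolds to the differential of such an expression, for conjugation by [g] and
    [a = b = c]. *)
Definition in_charts a b (psi : K -> K) x := coord b (psi (param a x)).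

Lemma in_charts_comp a b d (psi1 psi2 : K -> K) g :
  A a -> A b -> dom a g -> dom b (psi1 g) -> {for g, continuous psi1} ->
  differentiable (in_charts a b psi1) (coord a g) ->
  differentiable (in_charts b d psi2) (coord b (psi1 g)) ->
  differentiable (in_charts a d (psi2 \o psi1)) (coord a g) /\
  'd (in_charts a d (psi2 \o psi1)) (coord a g) =
  'd (in_charts b d psi2) (coord b (psi1 g)) \o
  'd (in_charts a b psi1) (coord a g) :> ('rV[R]_m -> 'rV[R]_m).
Proof.
move=> Aa Ab ag bg cpsi d1 d2.
have E : in_charts a b psi1 (coord a g) = coord b (psi1 g).
  by rewrite /in_charts coordK.
case: _ / E d2 => d2.
have near12 : {near coord a g,
    in_charts b d psi2 \o in_charts a b psi1 =1 in_charts a d (psi2 \o psi1)}.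
  have : nbhs g (psi1 @^-1` dom b) by exact/cpsi/chart_nbhs.
  move=> /(near_param Aa ag); apply: filterS => x /= bx.
  by rewrite /in_charts /= coordK.
have [d12 dE] := near_eq_diff near12 (differentiable_comp d1 d2).
have cE := diff_comp d1 d2.
split; first exact: d12.
exact: etrans dE cE.
Qed.

Lemma translate_cont g : continuous (fun h => g * h)%g /\
  continuous (fun h => h * g)%g.
Proof.
by split=> h; apply: (@continuous_comp _ _ _ (fun h => (_, _))
  (fun p : K * K => p.1 * p.2)%g h); try exact: (lie_mul_cont hK);
  apply: cvg_pair => //=; exact: cvg_cst.
Qed.

Lemma diff_ltranslate a b g h : A a -> A b -> dom a h -> dom b (g * h)%g ->
  differentiable (in_charts a b (fun h => g * h)%g) (coord a h).
Proof.
move=> Aa Ab ah bgh; have [d Ad dg] := lie_cover hK g.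
have [df _] := lie_mul_smooth hK Ad Aa Ab 1.
set f := (X in forall x, _ -> differentiable X x) in df.
have -> : in_charts a b (fun h => g * h)%g = f \o (fun x => (coord d g, x)).
  by apply/funext => x; rewrite /in_charts /f /= coordK.
apply: differentiable_comp; first exact: differentiable_pair.
by apply: df; split; rewrite /= ?coordK //; exact: coord_codom.
Qed.

Lemma diff_rtranslate a b g h : A a -> A b -> dom a h -> dom b (h * g)%g ->
  differentiable (in_charts a b (fun h => h * g)%g) (coord a h).
Proof.
move=> Aa Ab ah bgh; have [d Ad dg] := lie_cover hK g.
have [df _] := lie_mul_smooth hK Aa Ad Ab 1.
set f := (X in forall x, _ -> differentiable X x) in df.
have -> : in_charts a b (fun h => h * g)%g = f \o (fun x => (x, coord d g)).
  by apply/funext => x; rewrite /in_charts /f /= coordK.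
apply: differentiable_comp; first exact: differentiable_pair.
by apply: df; split; rewrite /= ?coordK //; exact: coord_codom.
Qed.

Context (c : chart R m K) (Ac : A c) (c1 : dom c 1%g).
Let e := coord c 1%g.

(** The intermediate point [g * h] may leave [dom c], so conjugation is factored through any chart
    [a] around it; near 1, [a = c] is a possible choice. *)
Lemma diff_conj g h : dom c h -> dom c (g * h * g^-1)%g ->
  differentiable (in_charts c c (fun h => g * h * g^-1)%g) (coord c h) /\
  forall a, A a -> dom a (g * h)%g ->
  'd (in_charts c c (fun h => g * h * g^-1)%g) (coord c h) =
  'd (in_charts a c (fun h => h * g^-1)%g) (coord a (g * h)%g) \o
  'd (in_charts c a (fun h => g * h)%g) (coord c h) :> ('rV[R]_m -> 'rV[R]_m).
Proof.
move=> ch cgh.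
have key a : A a -> dom a (g * h)%g -> _ := fun Aa agh =>
  in_charts_comp Ac Aa ch agh ((translate_cont g).1 h)
    (diff_ltranslate Ac Aa ch agh) (diff_rtranslate Aa Ac agh cgh).
split=> [|a Aa agh]; last by case: (key a Aa agh).
by have [a Aa agh] := lie_cover hK (g * h)%g; case: (key a Aa agh).
Qed.

Lemma diff_Ad g : differentiable (in_charts c c (fun h => g * h * g^-1)%g) e.
Proof. by case: (@diff_conj g 1%g) => //; rewrite mulg1 mulgV. Qed.

Lemma Ad_cont g : continuous (Ad c g).
Proof. exact: diff_continuous (diff_Ad g). Qed.

Lemma conj_cont g : continuous (fun h => g * h * g^-1)%g.
Proof.
move=> h; apply: (@continuous_comp _ _ _ (fun h => g * h)%g (fun h => h * g^-1)%g).
  exact: (translate_cont g).1.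
exact: (translate_cont (g^-1)%g).2.
Qed.

Lemma AdM g h X : Ad c (g * h)%g X = Ad c g (Ad c h X).
Proof.
have hh : (h * 1 * h^-1)%g = 1%g by rewrite mulg1 mulgV.
have := @in_charts_comp c c c (fun k => h * k * h^-1)%g (fun k => g * k * g^-1)%g 1%g.
rewrite hh => /(_ Ac Ac c1 c1 (conj_cont (g := h) (x := 1%g)) (diff_Ad h) (diff_Ad g)) [_ dE].
have -> : Ad c (g * h)%g = 'd (in_charts c c ((fun k => g * k * g^-1)%g \o
  (fun k => h * k * h^-1)%g)) e :> (_ -> _).
  rewrite /Ad; congr ('d _ _); apply/funext => x.
  by rewrite /in_charts /= invgM !mulgA.
exact: (congr1 (@^~ X) dE).
Qed.

Lemma Ad1 X : Ad c 1%g X = X.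
Proof.
have [||_ dE] := near_eq_diff (f := id)
    (g := in_charts c c (fun h => 1 * h * 1^-1)%g) (x := e) _ _.
- have := codom_nbhs Ac (coord_codom c1); apply: filterS => x cx.
  by rewrite /in_charts invg1 mulg1 mul1g (paramK Ac cx).2.
- by case: (is_diff_id e).
- by have [_ idE] := is_diff_id e; exact: (congr1 (@^~ X) (etrans dE idE)).
Qed.

Lemma AdK g X : Ad c g (Ad c (g^-1)%g X) = X.
Proof. by rewrite -AdM mulgV Ad1. Qed.


Let mu (p : 'rV[R]_m * 'rV[R]_m) := coord c (param c p.1 * param c p.2)%g.
Let iota (x : 'rV[R]_m) := coord c (param c x)^-1%g.
Let U2 := [set p : 'rV[R]_m * 'rV[R]_m |
  [/\ codom c p.1, codom c p.2 & dom c (param c p.1 * param c p.2)%g]].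

Let mu_diff p : U2 p -> differentiable mu p.
Proof. by have [+ _] := lie_mul_smooth hK Ac Ac Ac 1; apply. Qed.

Let muD_diff v p : U2 p -> differentiable (fun p => 'D_v mu p) p.
Proof. by have [_ /(_ v)[+ _]] := lie_mul_smooth hK Ac Ac Ac 2; apply. Qed.

Let param_e : param c e = 1%g.
Proof. exact: coordK. Qed.

Let U2_right x : codom c x -> U2 (x, e).
Proof.
move=> cx; split => //=; first exact: coord_codom.
by rewrite param_e mulg1; case: (paramK Ac cx).
Qed.

Let iota_e : iota e = e.
Proof. by rewrite /iota param_e invg1. Qed.

Let near_inv : \forall x \near e, codom c x /\ dom c (param c x)^-1%g.
Proof.
apply: filterI; first exact: codom_nbhs (coord_codom c1).
apply: (@near_param c 1%g [set g | dom c g^-1%g]) => //.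
apply: (lie_inv_cont hK (x := 1%g)); rewrite invg1; exact: chart_nbhs.
Qed.

(* Conjugation by g is left translation by g, that is mu (x, _), followed by
   right translation by g^-1, that is mu (_, iota x). *)
Let AdE x Y : codom c x -> dom c (param c x)^-1%g ->
  Ad c (param c x) Y =
  \sum_i 'D_(0, Y) mu (x, e) 0 i *: 'D_(delta_mx 0 i, 0) mu (x, iota x).
Proof.
move=> cx cx'; set g := param c x; have [cg gx] := paramK Ac cx.
have cg1 : dom c (g * 1)%g by rewrite mulg1.
have conj1 : dom c (g * 1 * g^-1)%g by rewrite mulg1 mulgV.
have [_ /(_ c Ac cg1)] := @diff_conj g 1%g c1 conj1.
have -> : coord c (g * 1)%g = x by rewrite mulg1.
move=> dE.
have -> : Ad c g Y = 'd (in_charts c c (fun h => h * g^-1)%g) x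
    ('d (in_charts c c (fun h => g * h)%g) e Y) by exact: (congr1 (@^~ Y) dE).
have U1 : U2 (x, e) by exact: U2_right.
have Ui : U2 (x, iota x).
  split => //=; first exact: coord_codom.
  by rewrite /iota coordK // mulgV.
have L : 'd (in_charts c c (fun h => g * h)%g) e Y = 'D_(0, Y) mu (x, e).
  have pd : is_diff e (fun y : 'rV[R]_m => (x, y)) (fun v => (0, v)).
    exact: is_diff_pair.
  rewrite deriveE; last exact: mu_diff.
  have [_ E] := is_diff_comp pd (differentiableP (mu_diff U1)).
  exact: (congr1 (@^~ Y) E).
have Rt v : 'd (in_charts c c (fun h => h * g^-1)%g) x v = 'D_(v, 0) mu (x, iota x).
  have pd : is_diff x (fun y : 'rV[R]_m => (y, iota x)) (fun v => (v, 0)).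
    exact: is_diff_pair.
  rewrite deriveE; last exact: mu_diff.
  have [_ E] := is_diff_comp pd (differentiableP (mu_diff Ui)).
  have -> : in_charts c c (fun h => h * g^-1)%g = mu \o (fun y => (y, iota x)).
    by apply/funext => y; rewrite /in_charts /mu /iota /= (coordK Ac cx').
  exact: (congr1 (@^~ v) E).
have expand u : 'd (in_charts c c (fun h => h * g^-1)%g) x u =
    \sum_i u 0 i *: 'D_(delta_mx 0 i, 0) mu (x, iota x).
  rewrite [in LHS](row_sum_delta u) linear_sum; apply: eq_bigr => i _.
  rewrite linearZ; congr (_ *: _); exact: Rt.
exact: etrans (congr1 _ L) (expand _).
Qed.

(** By [AdE], the coordinates of Ad are sums of products of first partial derivatives of [mu], which
    are differentiable since the multiplication is of class C^2. This makes [lie_bracket] a genuine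
    derivative. *)
Lemma differentiable_Ad Y : differentiable (fun x => Ad c (param c x) Y) e.
Proof.
pose F i x : R := 'D_(0, Y) mu (x, e) 0 i.
pose G i j x : R := 'D_(delta_mx 0 i, 0) mu (x, iota x) 0 j.
have dF i : differentiable (F i) e.
  apply: (@differentiable_comp _ _ _ _ (fun x => 'D_(0, Y) mu (x, e))
            (fun N => N 0 i)); last exact: differentiable_coord.
  apply: (@differentiable_comp _ _ _ _ (fun x => (x, e)) (fun p => 'D_(0, Y) mu p)).
    exact: differentiable_pair.
  by apply: muD_diff; exact/U2_right/coord_codom.
have diota : differentiable iota e.
  have [+ _] := lie_inv_smooth hK Ac Ac 1; apply; split; first exact: coord_codom.
  by rewrite param_e invg1.
have dG i j : differentiable (G i j) e.
  apply: (@differentiable_comp _ _ _ _ (fun x => 'D_(delta_mx 0 i, 0) mu (x, iota x))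
            (fun N => N 0 j)); last exact: differentiable_coord.
  apply: (@differentiable_comp _ _ _ _ (fun x => (x, iota x))
            (fun p => 'D_(delta_mx 0 i, 0) mu p)).
    exact: differentiable_pair.
  by apply: muD_diff; rewrite iota_e; exact/U2_right/coord_codom.
pose S := \sum_i \sum_j (fun x => (F i * G i j) x *: (delta_mx 0 j : 'rV[R]_m)).
have dS : differentiable S e.
  apply: differentiable_sum => i; apply: differentiable_sum => j.
  apply: differentiableZl; exact: differentiableM.
have [|//] := near_eq_diff (f := S) (g := fun x => Ad c (param c x) Y) _ dS.
move: near_inv; apply: filterS => x [cx cx'].
rewrite AdE // /S fct_sumE; apply: eq_bigr => i _; rewrite fct_sumE.
rewrite [in RHS](row_sum_delta ('D_(delta_mx 0 i, 0) mu (x, iota x))) scaler_sumr.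
by apply: eq_bigr => j _; rewrite scalerA.
Qed.

Lemma AdPr g (t : R) Y Z : Ad c g (t *: Y + Z) = t *: Ad c g Y + Ad c g Z.
Proof. exact: linearP. Qed.

Lemma Ad_comb g (s t : R) Y Z :
  Ad c g (s *: Y + t *: Z) = s *: Ad c g Y + t *: Ad c g Z.
Proof. by rewrite AdPr -[t *: Z]addr0 AdPr /Ad linear0 addr0. Qed.

(** This linearity lets the matrix inside [killing] represent the composite of two brackets. *)
Lemma lie_bracketPr (t : R) X Y Z :
  lie_bracket c X (t *: Y + Z) = t *: lie_bracket c X Y + lie_bracket c X Z.
Proof.
have dY := differentiable_Ad Y; have dZ := differentiable_Ad Z.
have wE : (fun x => Ad c (param c x) (t *: Y + Z)) =
    t *: (fun x => Ad c (param c x) Y) + (fun x => Ad c (param c x) Z).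
  by apply/funext => x; exact: AdPr.
have dE := diffD (differentiableZ t dY) dZ.
have dE' := congr1 (@^~ X) (diffZ t dY).
rewrite /lie_bracket wE.
exact: etrans (congr1 (@^~ X) dE) (congr1 (fun v => v + _) dE').
Qed.

(** Differentiate Ad(g k g^-1) Ad(g) Y = Ad(g) Ad(k) Y at k = 1 in the direction [X]. *)
Lemma Ad_lie_bracket g X Y :
  Ad c g (lie_bracket c X Y) = lie_bracket c (Ad c g X) (Ad c g Y).
Proof.
pose w Y x := Ad c (param c x) Y.
pose phi := in_charts c c (fun h => g * h * g^-1)%g.
have phie : phi e = e by rewrite /phi /in_charts param_e mulg1 mulgV.
have dAd : is_diff (w Y e) (Ad c g) (Ad c g).
  pose AdL : {linear 'rV[R]_m -> 'rV[R]_m} := 'd phi e.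
  split; first exact: (@linear_differentiable _ _ _ AdL _ (@Ad_cont g)).
  exact: (@diff_lin _ _ _ AdL _ (@Ad_cont g)).
have [_ E1] := is_diff_comp (differentiableP (differentiable_Ad Y)) dAd.
have dw : differentiable (w (Ad c g Y)) (phi e).
  by rewrite phie; exact: differentiable_Ad.
have E2 := diff_comp (diff_Ad g) dw.
have [] := near_eq_diff (f := w (Ad c g Y) \o phi) (g := Ad c g \o w Y) (x := e).
- have : nbhs 1%g [set h | dom c (g * h * g^-1)%g].
    by apply: (conj_cont (g := g) (x := 1%g)); rewrite mulg1 mulgV; exact: chart_nbhs.
  move=> /(near_param Ac c1); apply: filterS => x cx.
  transitivity (Ad c (g * param c x * g^-1)%g (Ad c g Y)).
    exact: (congr1 (fun k => Ad c k (Ad c g Y)) (coordK Ac cx)).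
  apply: etrans (esym (AdM _ _ _)) (etrans _ (AdM _ _ _)).
  by congr (Ad c _ Y); rewrite mulgVK.
- exact: differentiable_comp (diff_Ad g) dw.
- move=> _ E; have := congr1 (@^~ X) (etrans (esym E1) (etrans E E2)).
  have -> : 'd (w (Ad c g Y)) (phi e) = 'd (w (Ad c g Y)) e by rewrite phie.
  exact.
Qed.

Lemma killing_Ad g X Y : killing c (Ad c g X) (Ad c g Y) = killing c X Y.
Proof.
pose f X Y Z := lie_bracket c X (lie_bracket c Y Z).
have f_lin X' Y' : linear (f X' Y').
  by move=> a u v; rewrite /f !lie_bracketPr.
pose fL X' Y' : {linear _ -> _} :=
  HB.pack (f X' Y') (GRing.isLinear.Build _ _ _ _ _ (f_lin X' Y')).
pose AdL h : {linear 'rV[R]_m -> 'rV[R]_m} :=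
  'd (in_charts c c (fun k => h * k * h^-1)%g) e.
pose P := lin1_mx (AdL g); pose Q := lin1_mx (AdL g^-1%g).
have QP : Q *m P = 1%:M.
  apply/row_matrixP => i; rewrite !rowE mulmxA mulmx1 /Q /P.
  rewrite !(mul_rV_lin1 (AdL _)); exact: AdK.
have conj : lin1_mx (fL (Ad c g X) (Ad c g Y)) = Q *m lin1_mx (fL X Y) *m P.
  apply/row_matrixP => i; rewrite !rowE !mulmxA /Q /P.
  rewrite (mul_rV_lin1 (AdL _)) !(mul_rV_lin1 (fL _ _)) (mul_rV_lin1 (AdL _)).
  set v := delta_mx 0 i.
  transitivity (Ad c g (f X Y (Ad c g^-1%g v))); last by [].
  by rewrite /f !Ad_lie_bracket AdK.
rewrite /killing -[LHS]/(\tr (lin1_mx (fL (Ad c g X) (Ad c g Y)))) conj.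
by rewrite mxtrace_mulC mulmxA (mulmx1C QP) mul1mx.
Qed.

(** Invariance of the Killing form makes [minus_killing] equivariant: moving [X] by [Ad c g]
    precomposes its functional with the inverse of [Ad c g]. *)
Lemma coadjoint_orbit_Ad (O : set 'rV[R]_m) g X :
  is_coadjoint_orbit c O -> O X -> O (Ad c g X).
Proof.
move=> [l ->] [h _ hX]; exists (g * h)%g => //.
apply/funext => Y; rewrite invgM AdM.
rewrite (congr1 (@^~ (Ad c (g^-1)%g Y)) hX) /minus_killing.
by rewrite -[in RHS](AdK g Y) killing_Ad.
Qed.

(** The preimage of the hull under [Ad c g] is convex and contains the orbit. *)
Lemma convex_hull_Ad (O : set 'rV[R]_m) g X :
  is_coadjoint_orbit c O -> convex_hull O X -> convex_hull O (Ad c g X).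
Proof.
move=> hO OX.
pose B := [set Y | convex_hull O (Ad c g Y)].
have cvxB : @convex_set R 'rV[R]_m B.
  move=> x y t; rewrite !inE => Bx By C [cC OC].
  have CB Y : B Y -> C (Ad c g Y) by apply.
  have := cC (Ad c g x) (Ad c g y) t; rewrite !inE => /(_ (CB _ Bx) (CB _ By)).
  by rewrite -[X in X -> _]/(C (_ *: _ + _ *: _)) -Ad_comb.
apply: (OX B); split => // Y OY C [cC OC].
by apply: OC; exact: coadjoint_orbit_Ad.
Qed.

Lemma Ad_face (O F : set 'rV[R]_m) X (T : set K) : is_coadjoint_orbit c O ->
  is_face (convex_hull O) F -> F X ->
  (forall y, F y -> exists2 z, F z & open_segment y z X) ->
  is_subgroup T -> (forall t, T t -> Ad c t X = X) ->
  forall t, T t -> Ad c t @` F = F.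
Proof.
move=> hO [_ FO Fface] FX Xint [_ _ TV] TX.
have stable t y : T t -> F y -> F (Ad c t y).
  move=> Tt Fy; have [z Fz [s s01 sX]] := Xint y Fy.
  (* [X] is fixed, so it stays inside the moved segment; the face property then captures both moved
     end points. *)
  apply: (Fface (Ad c t y) (Ad c t z)).
  - by apply: convex_hull_Ad => //; exact: FO.
  - by apply: convex_hull_Ad => //; exact: FO.
  - by exists X; split => //; exists s => //; rewrite -Ad_comb sX TX.
  - by exists 0; rewrite /= ?in_itv /= ?lexx ?ler01 // subr0 scale1r scale0r addr0.
move=> t Tt; apply/seteqP; split => [_ [y Fy <-]|y Fy]; first exact: stable.
by exists (Ad c t^-1%g y); [apply: stable => //; exact: TV|exact: AdK].
Qed.

(** The error is proportional to the displacement of the second factor alone, so errors add up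
    linearly along a power. *)
Lemma chart_mul_first_order (eps : R) : 0 < eps ->
  exists2 d, 0 < d & forall x y, `|x - e| < d -> `|y - e| < d ->
    [/\ codom c x, codom c y, dom c (param c x * param c y)%g &
        `|coord c (param c x * param c y)%g - x - (y - e)| <= eps * `|y - e|].
Proof.
move=> eps0.
have Ue : U2 (e, e) by exact/U2_right/coord_codom.
have nU : \forall p \near (e, e), U2 p.
  have n11 : nbhs ((1%g, 1%g) : K * K) [set p | dom c (p.1 * p.2)%g].
    apply: (lie_mul_cont hK (x := (1%g, 1%g))); rewrite /= mulg1.
    exact: chart_nbhs.
  have [[V1 V2] /= [n1 n2] V12] := n11.
  exists ([set x | codom c x /\ V1 (param c x)],
          [set x | codom c x /\ V2 (param c x)]) => /=.
    by split; apply: filterI; rewrite ?nearE; try exact: near_param;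
      exact: codom_nbhs (coord_codom c1).
  move=> [x y] /= [[cx xV] [cy yV]]; split => //.
  exact: (V12 (param c x, param c y)).
have [||||d d0 Hd] := @unital_first_order R m mu e _ _ _ _ eps eps0.
- by apply: filterS nU => p; exact: mu_diff.
- move=> v; apply: differentiable_continuous; exact: muD_diff.
- apply: filterS (codom_nbhs Ac (coord_codom c1)) => x cx.
  by rewrite /mu /= param_e mulg1 (paramK Ac cx).2.
- apply: filterS (codom_nbhs Ac (coord_codom c1)) => x cx.
  by rewrite /mu /= param_e mul1g (paramK Ac cx).2.
have [d' /= d'0 Hd'] : nbhs_ball (e, e) U2 by exact/nbhs_ballP.
exists (Num.min d d'); first by rewrite lt_min d0.
move=> x y; rewrite !lt_min => /andP[xd xd'] /andP[yd yd'].
have [|? ? ?] := Hd' (x, y).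
  by split; rewrite -ball_normE /= distrC.
by split => //; exact: Hd.
Qed.

Lemma Ad_fix_velocity (gamma : R -> K) X g :
  (forall eps, 0 < eps -> exists2 d, 0 < d & forall s, 0 < s <= d ->
     dom c (gamma s) /\ `|coord c (gamma s) - e - s *: X| <= eps * s) ->
  (forall s, 0 < s -> g * gamma s = gamma s * g)%g -> Ad c g X = X.
Proof.
move=> gX gC.
apply: (@diff_fixed_velocity R _ (in_charts c c (fun h => g * h * g^-1)%g) e X
          (coord c \o gamma)).
- exact: diff_Ad.
- by rewrite /in_charts param_e mulg1 mulgV.
- move=> eps /gX[d d0 Hd]; exists d => // s sd; have [ds sX] := Hd s sd.
  split => //; rewrite /in_charts /= coordK // gC ?mulgK //.
  by case/andP: sd.
Qed.

End LieGroupCalculus.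

(** * One-parameter subgroups as limits of powers *)

Section OneParameterSubgroup.
Context (R : realType) (m : nat) (K : groupTopType).
Context (A : set (chart R m K)) (hK : is_lie_group A).
Hypothesis Kcompact : compact [set: K].
Context (c : chart R m K) (Ac : A c) (c1 : dom c 1%g).
Let e := coord c 1%g.

(** A single ultrafilter provides limits for all times at once, so algebraic relations between
    different times pass to the limit. *)
Lemma ultra_compact_cvg (I : Type) (T : topologicalType) (G : set_system I)
    (f : I -> T) : UltraFilter G -> compact [set: T] ->
  exists p : T, f @ G --> p.
Proof.
move=> UG cT; have PG : ProperFilter G := ultra_proper.
have [|p [_ fp]] := cT (f @ G) _; first exact: filterT.
exists p => B pB; have [//|nB] := in_ultra_setVsetC (f @^-1` B) UG.
by have [q [/= nBq /nBq]] := fp (~` B) B nB pB.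
Qed.

Lemma truncnD_carry (x y : R) : 0 <= x -> 0 <= y ->
  exists b : bool, Num.truncn (x + y) = (Num.truncn x + Num.truncn y + b)%N.
Proof.
move=> x0 y0; have xy0 : 0 <= x + y by exact: addr_ge0.
have /andP[x1 x2] := truncn_itv x0; have /andP[y1 y2] := truncn_itv y0.
have lo : (Num.truncn x + Num.truncn y <= Num.truncn (x + y))%N.
  by rewrite truncn_ge_nat // natrD lerD.
have hi : (Num.truncn (x + y) < (Num.truncn x + Num.truncn y).+2)%N.
  rewrite truncn_lt_nat // -addSn -addnS natrD; exact: ltrD.
have [le|lt] := leqP (Num.truncn (x + y)) (Num.truncn x + Num.truncn y).
  by exists false; rewrite addn0; apply/eqP; rewrite eqn_leq le.
by exists true; rewrite addn1; apply/eqP; rewrite eqn_leq lt andbT -ltnS.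
Qed.

(** Each further factor adds an error of at most [eps] times the norm of [h]. The factor [1 + eps]
    in the hypothesis keeps all intermediate powers within [d], where the product estimate
    applies. *)
Lemma chart_expg (eps d : R) : 0 < eps ->
  (forall x y, `|x - e| < d -> `|y - e| < d ->
    [/\ codom c x, codom c y, dom c (param c x * param c y)%g &
        `|coord c (param c x * param c y)%g - x - (y - e)| <= eps * `|y - e|]) ->
  forall h k, `|h| < d -> k%:R * (1 + eps) * `|h| < d ->
  dom c (param c (e + h) ^+ k)%g /\
  `|coord c (param c (e + h) ^+ k)%g - e - k%:R *: h| <= eps * (k%:R * `|h|).
Proof.
move=> eps0 Hd h k hd; elim: k => [|k IHk] kd.
  by rewrite expg0 scale0r mul0r mulr0 subr0 subrr normr0.
have [] := IHk.
  apply: le_lt_trans kd; rewrite -!mulrA ler_wpM2r ?ler_nat //.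
  by rewrite mulr_ge0 // addr_ge0 // ltW.
set x := coord c _ => cx xk.
have xd : `|x - e| < d.
  rewrite -(subrK (k%:R *: h) (x - e)); apply: le_lt_trans (ler_normD _ _) _.
  rewrite normrZ normr_nat; apply: le_lt_trans kd.
  apply: (@le_trans _ _ (k%:R * (1 + eps) * `|h|)).
    have -> : k%:R * (1 + eps) * `|h| = eps * (k%:R * `|h|) + k%:R * `|h| by ring.
    by rewrite lerD2r.
  rewrite -!mulrA ler_wpM2r ?ler_nat //.
  by rewrite mulr_ge0 // addr_ge0 // ltW.
have yd : `|e + h - e| < d by rewrite addrC addKr.
have [_ _] := Hd _ _ xd yd.
rewrite (coordK hK Ac cx) -expgSr [e + h]addrC addrK => ck xk1.
split => //; rewrite [h + e]addrC in ck xk1 *.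
set z := coord c _ in xk1 *.
have -> : z - e - k.+1%:R *: h = (z - x - h) + (x - e - k%:R *: h).
  by apply/rowP => i; rewrite !mxE -natr1; ring.
apply: le_trans (ler_normD _ _) _; apply: le_trans (lerD xk1 xk) _.
by rewrite -mulrDr -natr1 mulrDl mul1r addrC.
Qed.

(** A limit in K is not known in advance to lie in the chart. Membership in this closed image passes
    to limits and yields both the chart domain and the estimate. *)
Lemma param_ball_closed (x : 'rV[R]_m) (r : R) :
  [set y | `|x - y| <= r] `<=` codom c -> closed (param c @` [set y | `|x - y| <= r]).
Proof.
move=> rc; have [r0|r0] := ltP r 0.
  suff -> : [set y | `|x - y| <= r] = set0 by rewrite image_set0; exact: closed0.
  rewrite -subset0 => y /= xy; have := normr_ge0 (x - y).
  by rewrite leNgt (le_lt_trans xy r0).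
apply: compact_closed; first exact: lie_hausdorff hK.
apply: continuous_compact.
  apply: continuous_in_subspaceT => y; rewrite inE => /rc.
  exact: chart_param_cont (lie_chart hK Ac) y.
apply: bounded_closed_compact.
  exists (`|x| + r); split; first exact: num_real.
  move=> M xrM y /= xy; apply: le_trans (ltW xrM).
  rewrite -[y](subKr x); apply: le_trans (ler_normB _ _) _.
  by rewrite lerD2l.
have -> : [set y | `|x - y| <= r] = (fun y => `|x - y|) @^-1` [set t | t <= r] by [].
apply: closed_comp; last exact: closed_le.
move=> y _; exact: (cvg_norm (cvgB (cvg_cst x) (@cvg_id _ (nbhs y)))).
Qed.

(* gamma s is a limit of the powers g_n ^ (floor (s n)), g_n being the point at
   X / n in the chart. The floor is additive up to a factor g_n, which tends to
   1, and the first-order estimate for the product survives the limit. *)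
Lemma one_parameter_subgroup (X : 'rV[R]_m) : exists gamma : R -> K,
  (forall s t, 0 <= s -> 0 <= t -> gamma (s + t) = gamma s * gamma t)%g /\
  (forall eps, 0 < eps -> exists2 d, 0 < d & forall s, 0 < s <= d ->
     dom c (gamma s) /\ `|coord c (gamma s) - e - s *: X| <= eps * s).
Proof.
have hausK := lie_hausdorff hK.
have [G [UG ooG]] := ultraFilterLemma (F := \oo) _.
have PG : ProperFilter G by exact: ultra_proper.
pose h n : 'rV[R]_m := n.+1%:R^-1 *: X.
pose g n := param c (e + h n).
pose a (s : R) (n : nat) : K := (g n ^+ Num.truncn (s * n.+1%:R))%g.
have /choice[gamma gammaP] : forall s, exists p : K, a s @ G --> p.
  by move=> s; exact: ultra_compact_cvg.
have h0 (r : R) : 0 < r -> \forall n \near \oo, `|h n| < r.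
  move=> r0; have X1 : 0 < `|X| + 1 by rewrite ltr_wpDl.
  have r1 : 0 < r / (`|X| + 1) by rewrite divr_gt0.
  apply: filterS (near_infty_natSinv_lt (PosNum r1)) => n /=.
  rewrite ltr_pdivlMr // => nr; rewrite normrZ ger0_norm ?invr_ge0 //.
  by apply: le_lt_trans nr; rewrite ler_pM2l ?invr_gt0 // lerDl.
have g1 : g @ G --> 1%g.
  move=> B B1; apply: ooG.
  have := near_param hK Ac c1 B1.
  move=> /nbhs_ballP[r /= r0 Hr]; apply: filterS (h0 r r0) => n hn.
  by apply: Hr; rewrite -ball_normE /= -/e opprD addrA subrr sub0r normrN.
exists gamma; split.
  move=> s t s0 t0; apply: (cvg_unique hausK (gammaP (s + t))).
  have bP n : exists b : bool, a (s + t) n = (a s n * a t n * g n ^+ b)%g.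
    have N0 : 0 <= n.+1%:R :> R by [].
    have [b bE] := truncnD_carry (mulr_ge0 s0 N0) (mulr_ge0 t0 N0).
    by exists b; rewrite /a mulrDl bE !expgnDr.
  have /choice[b bE] := bP.
  have gb : (fun n => g n ^+ b n)%g @ G --> 1%g.
    move=> B B1; apply: (@filterS _ G _ (g @^-1` B)) (g1 B B1) => n Bn /=.
    case: (b n); first by rewrite expg1.
    by rewrite expg0; exact: (nbhs_singleton B1).
  have -> : a (s + t) = (fun n => a s n * a t n * g n ^+ b n)%g by exact/funext.
  rewrite /= -[(gamma s * gamma t)%g]mulg1.
  have mulK (u v : nat -> K) p q : u @ G --> p -> v @ G --> q ->
      (fun n => u n * v n)%g @ G --> (p * q)%g.
    move=> up vq; apply: (@continuous2_cvg _ K K K G _ u v (fun p q => p * q)%g p q).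
    - exact: (lie_mul_cont hK (x := (p, q))).
    - exact: up.
    - exact: vq.
  by apply: (mulK (fun n => a s n * a t n)%g); first exact: mulK.
move=> eps eps0.
have X1 : 0 < `|X| + 1 by rewrite ltr_wpDl.
pose eps' := eps / (`|X| + 1); have eps'0 : 0 < eps' by rewrite divr_gt0.
have [d d0 Hd] := chart_mul_first_order hK Ac c1 eps'0.
have [r /= r0 Hr] : nbhs_ball e (codom c).
  by apply/nbhs_ballP; exact: (codom_nbhs hK Ac (coord_codom c1)).
(* [s * D] bounds both the reach of the powers and the distance from [e] within the target ball; the
   factor 2 below gives strict inequalities. *)
pose D := (1 + eps') * (`|X| + 1).
have D0 : 0 < D by apply: mulr_gt0 => //; apply: addr_gt0.
have DE : `|X| + 1 + eps = D by rewrite /D mulrDl mul1r divfK ?gt_eqF.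
have D2 : 0 < 2 * D by exact: mulr_gt0.
exists (Num.min d r / (2 * D)); first by rewrite divr_gt0 // lt_min d0.
move=> s /andP[s0 sdr].
have /andP[sd sr] : (s * (2 * D) <= d) && (s * (2 * D) <= r).
  by rewrite -le_min -ler_pdivlMr.
have sD : 0 < s * D by rewrite mulr_gt0.
have ballc : [set y | `|e + s *: X - y| <= eps * s] `<=` codom c.
  move=> y /= yX; apply: Hr; rewrite -ball_normE /=.
  have -> : e - y = (e + s *: X - y) - s *: X by rewrite addrAC addrK.
  apply: le_lt_trans (ler_normB _ _) _; rewrite normrZ gtr0_norm //.
  nra.
suff [x /= xX <-] : (param c @` [set y | `|e + s *: X - y| <= eps * s]) (gamma s).
  have [dx ->] := paramK hK Ac (ballc _ xX).
  by split => //; rewrite -addrA -opprD distrC.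
apply: (closed_cvg _ (param_ball_closed ballc)) (gammaP s).
apply: ooG.
have es0 : 0 < eps' * s by rewrite mulr_gt0.
apply: filterS2 (h0 _ d0) (h0 _ es0) => n hd hes.
set k := Num.truncn (s * n.+1%:R).
have kh : k%:R * `|h n| <= s * `|X|.
  rewrite normrZ ger0_norm ?invr_ge0 // mulrA ler_wpM2r // ler_pdivrMr //.
  by rewrite truncn_le mulr_ge0 // ltW.
have [|dk ck] := chart_expg eps'0 Hd (k := k) hd.
  rewrite mulrAC; apply: (@le_lt_trans _ _ (s * D)); last lra.
  rewrite /D [(1 + _) * _]mulrC mulrA ler_pM2r ?addr_gt0 //.
  by apply: le_trans kh _; rewrite ler_pM2l // lerDl.
exists (coord c (g n ^+ k)%g); last by rewrite (coordK hK Ac).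
rewrite /= distrC opprD addrA; set y := coord c _.
have -> : y - e - s *: X = (y - e - k%:R *: h n) - (s *: X - k%:R *: h n).
  by apply/rowP => i; rewrite !mxE; ring.
apply: le_trans (ler_normB _ _) _.
(* The first part pays for the power estimate, the second for rounding [s] to a multiple of 1 / (n +
   1). *)
have -> : eps * s = eps' * (s * `|X|) + eps' * s.
  by rewrite /eps'; field; rewrite gt_eqF.
apply: lerD; first by apply: le_trans ck _; rewrite ler_pM2l.
apply: le_trans (ltW hes); rewrite /h scalerA -scalerBl !normrZ ler_wpM2r //.
rewrite [leRHS]ger0_norm ?invr_ge0 // ler_norml.
have /andP[k1 k2] : k%:R <= s * n.+1%:R < k.+1%:R by apply: truncn_itv; rewrite mulr_ge0 // ltW.
have kN : k%:R / n.+1%:R <= s by rewrite ler_pdivrMr.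
have : s < k.+1%:R / n.+1%:R by rewrite ltr_pdivlMr.
have Ni : 0 < n.+1%:R^-1 :> R by rewrite invr_gt0.
rewrite -[k.+1%:R]natr1 mulrDl mul1r => sk.
set u := n.+1%:R^-1 in kN Ni sk *; set v := k%:R * u in kN sk *.
by apply/andP; split; lra.
Qed.

End OneParameterSubgroup.

(** * The torus generated by a velocity *)

Section Stabiliser.
Context (R : realType) (m : nat) (K : groupTopType).
Context (A : set (chart R m K)) (hK : is_lie_group A).
Hypothesis Kcompact : compact [set: K].
Context (c : chart R m K) (Ac : A c) (c1 : dom c 1%g).

Lemma velocity_cvg1 (gamma : R -> K) (X : 'rV[R]_m) :
  (forall eps, 0 < eps -> exists2 d, 0 < d & forall s, 0 < s <= d ->
     dom c (gamma s) /\ `|coord c (gamma s) - coord c 1%g - s *: X| <= eps * s) ->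
  forall B, nbhs 1%g B -> exists2 d, 0 < d & forall s, 0 < s <= d -> B (gamma s).
Proof.
move=> gX B B1; have [d d0 Hd] := gX 1 ltr01.
have /nbhs_ballP[r /= r0 Hr] := near_param hK Ac c1 B1.
have X1 : 0 < `|X| + 2 by rewrite ltr_wpDl.
exists (Num.min d (r / (2 * (`|X| + 2)))); first by rewrite lt_min d0 divr_gt0 // mulr_gt0.
move=> s /andP[s0]; rewrite le_min => /andP[sd sr].
have [|ds sX] := Hd s; first by rewrite s0.
rewrite -(coordK hK Ac ds); apply: Hr; rewrite -ball_normE /= distrC.
rewrite -(subrK (s *: X) (coord c (gamma s) - _)).
apply: le_lt_trans (ler_normD _ _) _; rewrite normrZ gtr0_norm //.
have : s * (2 * (`|X| + 2)) <= r by rewrite -ler_pdivlMr // mulr_gt0.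
have := normr_ge0 X; nra.
Qed.

(** For two nonnegative times, the values of [gamma] differ by the value at the gap or by its
    inverse, so continuity reduces to the limit at 1. The absolute value extends the curve to all of
    R. *)
Lemma one_parameter_continuous (gamma : R -> K) :
  (forall s t, 0 <= s -> 0 <= t -> gamma (s + t) = gamma s * gamma t)%g ->
  (forall B, nbhs 1%g B -> exists2 d, 0 < d & forall s, 0 < s <= d -> B (gamma s)) ->
  continuous (fun t : R => gamma `|t|).
Proof.
move=> gD g1 t B /= Bt.
have gamma0 : gamma 0 = 1%g.
  by apply: (mulgI (gamma 0)); rewrite -gD // addr0 mulg1.
have nB1 : nbhs 1%g [set u | B (gamma `|t| * u)%g].
  by apply: ((translate_cont hK (gamma `|t|)).1 1%g); rewrite mulg1.
have nB2 : nbhs 1%g [set u | B (gamma `|t| * u^-1)%g].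
  by have := lie_inv_cont hK (x := 1%g); rewrite /continuous_at invg1 => /(_ _ nB1).
have [d d0 Hd] := g1 _ (filterI nB1 nB2).
apply/nbhs_ballP; exists d => //= s; rewrite -ball_normE /= => ts.
have std : `| `|t| - `|s| | < d by apply: le_lt_trans ts; exact: ler_dist_dist.
have [lt|lt|eq] := ltgtP `|t| `|s|.
- have [|+ _] := Hd (`|s| - `|t|).
    by rewrite subr_gt0 lt /=; apply: le_trans (ltW std); rewrite distrC ler_norm.
  have d0' : 0 <= `|s| - `|t| by rewrite subr_ge0 ltW.
  by rewrite /= -gD // addrC subrK.
- have [|_ +] := Hd (`|t| - `|s|).
    by rewrite subr_gt0 lt /=; apply: le_trans (ltW std); rewrite ler_norm.
  have d0' : 0 <= `|t| - `|s| by rewrite subr_ge0 ltW.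
  have tE : gamma `|t| = (gamma `|s| * gamma (`|t| - `|s|))%g.
    by rewrite -gD // addrC subrK.
  by rewrite /= tE mulgK.
- by rewrite -eq; exact: nbhs_singleton Bt.
Qed.

Lemma one_parameter_torus (gamma : R -> K) :
  (forall s t, 0 <= s -> 0 <= t -> gamma (s + t) = gamma s * gamma t)%g ->
  continuous (fun t : R => gamma `|t|) ->
  exists2 S, is_torus S & forall s, 0 <= s -> S (gamma s).
Proof.
move=> gD gC.
(* Inverses are not values of [gamma] a priori, so the subgroup consists of quotients. For fixed [t]
   they form a connected curve through 1, reached at [s = t]. *)
pose f (t s : R) := (gamma `|s| * (gamma `|t|)^-1)%g.
pose H := \bigcup_t (f t @` [set: R]).
have gcomm (s t : R) : (gamma `|s| * gamma `|t| = gamma `|t| * gamma `|s|)%g.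
  by rewrite -!gD // addrC.
have fC s t s' t' : (f t s * f t' s' = f t' s' * f t s)%g.
  have gV (u v : R) : commute (gamma `|u|) (gamma `|v|)^-1%g by exact/commuteV/gcomm.
  have gVV (u v : R) : commute (gamma `|u|)^-1%g (gamma `|v|)^-1%g.
    exact/commuteV/commute_sym/gV.
  have gf (u : R) : commute (gamma `|u|) (f t' s').
    by apply: commuteM; [exact: gcomm|exact: gV].
  have gVf (u : R) : commute (gamma `|u|)^-1%g (f t' s').
    by apply: commuteM; [exact/commute_sym/gV|exact: gVV].
  by apply/commute_sym/commuteM; [exact/commute_sym/gf|exact/commute_sym/gVf].
have fM s t s' t' : (f t s * f t' s' = f (`|t| + `|t'|) (`|s| + `|s'|))%g.
  have gV : ((gamma `|t|)^-1 * gamma `|s'| = gamma `|s'| * (gamma `|t|)^-1)%g.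
    by apply/commute_sym/commuteV/gcomm.
  have normD (u v : R) : `| `|u| + `|v| | = `|u| + `|v| :> R by rewrite ger0_norm ?addr_ge0.
  rewrite /f !normD !gD // (gcomm t t') invgM !mulgA; congr (_ * _)%g.
  by rewrite -!mulgA gV.
have H1 : forall t, f t t = 1%g by move=> t; rewrite /f mulgV.
have gamma0 : gamma 0 = 1%g.
  by apply: (mulgI (gamma 0)); rewrite -gD // addr0 mulg1.
exists (closure H); last first.
  move=> s s0; apply: subset_closure; exists 0 => //; exists s => //.
  by rewrite /f normr0 gamma0 invg1 mulg1 ger0_norm.
apply: closure_torus Kcompact (lie_mul_cont hK) (lie_inv_cont hK) _ _ _ _.
- exact: lie_hausdorff hK.
- split.
  + by exists 0 => //; exists 0.
  + move=> g h [t _ [s _ <-]] [t' _ [s' _ <-]].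
    by rewrite fM; eexists => //; eexists.
  + move=> g [t _ [s _ <-]]; exists s => //; exists t => //.
    by rewrite /f invgM invgK.
- apply: bigcup_connected.
    by exists 1%g => t _; exists t.
  move=> t _; apply: connected_continuous_connected.
    by apply/connected_intervalP.
  apply: continuous_subspaceT => s.
  apply: (@continuous_comp _ _ _ (fun s : R => gamma `|s|) (fun h => h * _)%g).
    exact: gC.
  exact: (translate_cont hK _).2.
- by move=> g h [t _ [s _ <-]] [t' _ [s' _ <-]].
Qed.

Lemma maximal_torus_fixing (X : 'rV[R]_m) :
  exists2 T, is_maximal_torus T & forall t, T t -> Ad c t X = X.
Proof.
have [gamma [gD gX]] := one_parameter_subgroup hK Kcompact Ac c1 X.
have gC := one_parameter_continuous gD (velocity_cvg1 gX).
have [S torS Sg] := one_parameter_torus gD gC.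
have [T maxT ST] := sub_maximal_torus (lie_hausdorff hK) Kcompact
  (lie_mul_cont hK) (lie_inv_cont hK) torS.
exists T => // t Tt; apply: (Ad_fix_velocity hK Ac c1 gX) => s s0.
by case: maxT => -[_ _ _ Tab] _; apply: Tab => //; exact/ST/Sg/ltW.
Qed.

End Stabiliser.

Theorem corollary27 (R : realType) (m : nat) (K : groupTopType)
    (A : set (chart R m K)) (hK : is_lie_group A)
    (Kcompact : compact [set: K]) (Kconnected : connected [set: K])
    (c : chart R m K) (Ac : A c) (c1 : dom c 1%g)
    (Ksemisimple : semisimple c)
    (O : set 'rV[R]_m) (hO : is_coadjoint_orbit c O)
    (F : set 'rV[R]_m) (hF : is_face (convex_hull O) F) :
  exists T : set K,
    is_maximal_torus T /\ (forall t, T t -> Ad c t @` F = F).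
Proof.
(* The empty set counts as a face and has no interior point to fix; any maximal torus preserves it,
   for instance one fixing 0. *)
have [F0|F0] := pselect (F !=set0); last first.
  have [T maxT _] := maximal_torus_fixing hK Kcompact Ac c1 0.
  exists T; split => // t _.
  have -> : F = set0 by apply: contrapT => /eqP/set0P.
  by rewrite image_set0.
have [cF _ _] := hF.
have [X FX Xint] := convex_relative_interior cF F0.
have [T maxT TX] := maximal_torus_fixing hK Kcompact Ac c1 X.
exists T; split => //; apply: (Ad_face hK Ac c1 hO hF FX Xint _ TX).
by case: maxT => -[].
Qed.
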